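(* Fix $n\ge10$. Let $S_n$ be the symmetric group, $D_n\subset S_n$ the set of derangements, $K$ the $\frac12$-lazy random transposition walk on $S_n$, and $Q$ its Metropolized restriction to $D_n$ (as defined in the context). Then there is a real number $\epsilon_n$ with $|\epsilon_n|\le\frac{13}{n}$ such that every function $f:D_n\to\mathbb{R}$ has an extension $\widehat f:S_n\to\mathbb{R}$ (i.e. $\widehat f=f$ on $D_n$) satisfying $$\mathcal{E}_K(\widehat f,\widehat f)\le 22(e+1)(1+\epsilon_n)\,\mathcal{E}_Q(f,f).$$ In the other direction, for any function $f:D_n\to\mathbb{R}$ and any extension $\widehat f:S_n\to\mathbb{R}$ of $f$, $$\mathcal{E}_K(\widehat f,\widehat f)\ge\frac{1}{2e}\,\mathcal{E}_Q(f,f).$$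
   Context: A permutation $\sigma\in S_n$ is a derangement if $\sigma(i)\ne i$ for all $i\in\{1,\dots,n\}$. Let $d=\binom n2$; write $x\sim y$ for $x,y\in S_n$ when $y^{-1}x$ is a transposition. The kernel $K$ on $S_n$: $K(x,x)=\frac12$, $K(x,y)=\frac1{2d}$ if $x\sim y$, and $0$ otherwise; its stationary distribution is uniform on $S_n$. The kernel $Q$ on $D_n$: $Q(x,y)=\frac1{2d}$ if $x\sim y$ with $x,y\in D_n$, $Q(x,x)=1-\frac1{2d}|\{y\in D_n:y\sim x\}|$, and $0$ otherwise; its stationary distribution is uniform on $D_n$. For a kernel $P$ on a finite set $X$ with stationary distribution $\pi$, $\mathcal{E}_P(f,f)=\frac12\sum_{x,y\in X}|f(x)-f(y)|^2P(x,y)\pi(x)$. *)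

(* Defs.v *)
From HB Require Import structures.
From mathcomp Require Import all_boot all_order all_algebra all_fingroup.
From mathcomp Require Import reals.

Set Implicit Arguments.
Unset Strict Implicit.
Unset Printing Implicit Defensive.

Import Order.TTheory GRing.Theory Num.Theory.
Local Open Scope ring_scope.

Definition derangements (n : nat) : {set 'S_n} :=
  [set s : 'S_n | [forall i, s i != i]].

Notation D_ n := {s : 'S_n | s \in derangements n}.

Definition is_transposition (n : nat) (s : 'S_n) : bool :=
  [exists i, exists j, (i != j) && (s == tperm i j)].

(* MathComp multiplies permutations left to right; this does not affect the
   relation, because the transpositions form a conjugacy class. *)
Definition adj (n : nat) (x y : 'S_n) : bool :=
  is_transposition (y^-1 * x)%g.

Definition kerK (R : realType) (n : nat) (x y : 'S_n) : R :=
  if x == y then 1 / 2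
  else if adj x y then 1 / (2 * 'C(n, 2)%:R)
  else 0.

Definition kerQ (R : realType) (n : nat) (x y : D_ n) : R :=
  if x == y then
    1 - 1 / (2 * 'C(n, 2)%:R) * #|[set z : D_ n | adj (val z) (val x)]|%:R
  else if adj (val x) (val y) then 1 / (2 * 'C(n, 2)%:R)
  else 0.

Definition uniform (R : realType) (X : finType) (x : X) : R := #|X|%:R^-1.

(* pi stands for the stationary distribution of P; kerK and kerQ are symmetric
   with rows summing to 1 (n >= 2 for kerK), so for them it is uniform. *)
Definition dirichlet (R : realType) (X : finType)
    (P : X -> X -> R) (pi : X -> R) (f : X -> R) : R :=
  1 / 2 * \sum_(x : X) \sum_(y : X) `|f x - f y| ^+ 2 * P x y * pi x.

Definition formK (R : realType) (n : nat) (f : 'S_n -> R) : R :=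
  dirichlet (@kerK R n) (@uniform R _) f.

Definition formQ (R : realType) (n : nat) (f : D_ n -> R) : R :=
  dirichlet (@kerQ R n) (@uniform R _) f.

Definition extends (R : realType) (n : nat)
    (fhat : 'S_n -> R) (f : D_ n -> R) : Prop :=
  forall x : D_ n, fhat (val x) = f x.

(* Main.v *)
Require Import Defs.
From HB Require Import structures.
From mathcomp Require Import all_boot all_order all_algebra all_fingroup.
From mathcomp Require Import reals sequences exp.
From mathcomp Require Import ring lra.

Set Implicit Arguments.
Unset Strict Implicit.
Unset Printing Implicit Defensive.

Import Order.TTheory GRing.Theory Num.Theory.
Local Open Scope ring_scope.

(* Extend [f] one point at a time: from the permutations with no fixed point in
   [F] to those with no fixed point in [F :\ m]. A new permutation [s] fixes
   [m], and all the [s (m j)], [j != m], already lie in the smaller set; let the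
   extension at [s] be the mean of [f] over them. With [N = n - 1]:
   - an edge between new permutations [s], [s (a b)] is the mean over [j] of the
     edges [s (m j)], [s (m j) (a b)], at cost [1 / N];
   - an edge from [s] to some [s (m j)] costs a variance, hence the differences
     of [f] between [s (m j)] and [s (m l)]; these two are joined inside the
     smaller set through [s (m j) (j l) = s (m l) (m j)], unless [l = s j].
     The cost is [2 / (N - 2)].
   The [n] steps together lose at most
   [(1 + 1 / (n - 1) + 2 / (n - 3)) ^ n <= e ^ 4 < 22 (e + 1)], so [eps = 0]
   works. The insertion map [(s, j) |-> s (m j)] is injective, which also gives
   [n! <= (n / (n - 1)) ^ n |D_n| <= 2 e |D_n|] and thereby the lower bound. *)

(** * Permutations without fixed points in a given set, and insertion of a point *)

Definition avoid (n : nat) (F : {set 'I_n}) : {set 'S_n} :=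
  [set s : 'S_n | [forall i in F, s i != i]].

Lemma avoidP (n : nat) (F : {set 'I_n}) (s : 'S_n) :
  reflect (forall i, i \in F -> s i != i) (s \in avoid F).
Proof. by rewrite inE; apply: (iffP forall_inP). Qed.

Definition avoid_fix (n : nat) (F : {set 'I_n}) (m : 'I_n) : {set 'S_n} :=
  [set s : 'S_n in avoid (F :\ m) | s m == m].

Lemma in_avoid_fix (n : nat) (F : {set 'I_n}) (m : 'I_n) (s : 'S_n) :
  (s \in avoid_fix F m) = (s \in avoid (F :\ m)) && (s m == m).
Proof. by rewrite [LHS]inE. Qed.

(** Only two images change: [m] now goes to [j], and the preimage of [j] goes to [m]. Neither
    becomes a fixed point. *)
Lemma insert_avoid (n : nat) (F : {set 'I_n}) (m j : 'I_n) (s : 'S_n) :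
  s \in avoid_fix F m -> j != m -> (s * tperm m j)%g \in avoid F.
Proof.
rewrite in_avoid_fix => /andP[/avoidP sF /eqP sm] jm; apply/avoidP => i iF.
rewrite permM; case: tpermP => [sim|sij|/eqP sim _].
- by rewrite (perm_inj (etrans sim (esym sm))).
- apply: contraNneq jm => mi; apply/eqP.
  by rewrite -sij -mi sm.
- by apply: sF; rewrite !inE iF andbT; apply: contraNneq sim => ->; rewrite sm.
Qed.

(** The product sends [m] to [l], the preimage of [j] to [m] and the preimage of [l] to [j]. The
    last one is a fixed point exactly when [l = s j]. *)
Lemma insert_cycle_avoid (n : nat) (F : {set 'I_n}) (m j l : 'I_n) (s : 'S_n) :
    s \in avoid_fix F m -> j != m -> l != m -> l != j -> l != s j ->
  (s * tperm m j * tperm j l)%g \in avoid F.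
Proof.
rewrite in_avoid_fix => /andP[/avoidP sF /eqP sm] jm lm lj lsj.
apply/avoidP => i iF; rewrite !permM.
case: (tpermP m j (s i)) => [sim|sij|/eqP sim /eqP sij].
- by rewrite tpermL (perm_inj (etrans sim (esym sm))).
- rewrite tpermD //; apply: contraNneq jm => mi; apply/eqP.
  by rewrite -sij -mi sm.
- case: tpermP => [/eqP|sil|_ _]; first by rewrite (negPf sij).
    by apply: contraNneq lsj => ->; rewrite sil.
  by apply: sF; rewrite !inE iF andbT; apply: contraNneq sim => ->; rewrite sm.
Qed.

Lemma avoidD1 (n : nat) (F : {set 'I_n}) (m : 'I_n) :
  m \in F -> avoid (F :\ m) = avoid F :|: avoid_fix F m.
Proof.
move=> mF; apply/setP => s; apply/idP/idP; rewrite in_setU in_avoid_fix.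
  case: (boolP (s m == m)) => sm; rewrite ?andbT; first by move=> ->; rewrite orbT.
  move=> /avoidP sF; rewrite andbF orbF; apply/avoidP => i iF.
  by case: (eqVneq i m) => [->//|im]; apply: sF; rewrite !inE im.
case/orP => [/avoidP sF|/andP[]//].
by apply/avoidP => i; rewrite !inE => /andP[_]; apply: sF.
Qed.

Lemma avoid_disjoint (n : nat) (F : {set 'I_n}) (m : 'I_n) :
  m \in F -> [disjoint avoid F & avoid_fix F m].
Proof.
move=> mF; apply/pred0P => s /=; apply/negP => /andP[/avoidP sF].
by rewrite in_avoid_fix => /andP[_]; apply/negP/sF.
Qed.

(** The index [j] is recovered as the image of [m], and then [s] by cancelling [tperm m j]. Terms
    outside the image of this injection are nonnegative and dropped. *)
Lemma sum_insert (R : realType) (n : nat) (F : {set 'I_n}) (m : 'I_n)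
    (G : 'S_n -> R) : (forall s, 0 <= G s) ->
  \sum_(s in avoid_fix F m) \sum_(j | j != m) G (s * tperm m j)%g
    <= \sum_(s in avoid F) G s.
Proof.
move=> G0; rewrite pair_big /=.
pose P := [pred p : 'S_n * 'I_n | (p.1 \in avoid_fix F m) && (p.2 != m)].
pose h (p : 'S_n * 'I_n) := (p.1 * tperm m p.2)%g.
have hm (p : 'S_n * 'I_n) : p.1 m = m -> h p m = p.2.
  by move=> pm; rewrite permM pm tpermL.
have h_inj : {in P &, injective h}.
  move=> [s j] [t k] /andP[]; rewrite /= in_avoid_fix => /andP[_ /eqP sm] _.
  move=> /andP[]; rewrite /= in_avoid_fix => /andP[_ /eqP tm] _ hst.
  have jk : j = k by have := hm (s, j) sm; rewrite hst hm.
  by congr (_, _) => //; move: hst; rewrite /h /= jk => /mulIg.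
rewrite -(big_imset G h_inj) /=.
have sub : h @: P \subset avoid F.
  by apply/subsetP => _ /imsetP[p /andP[sY jm] ->]; apply: insert_avoid.
rewrite [leRHS](big_setID (h @: P)) /=.
by rewrite (setIidPr sub) lerDl sumr_ge0.
Qed.

(** * Unnormalised energy between two sets of permutations *)

Definition edge (R : realType) (n : nat) (B : {set 'S_n}) (f : 'S_n -> R)
    (x : 'S_n) (a b : 'I_n) : R :=
  (x * tperm a b \in B)%g%:R * (f x - f (x * tperm a b)%g) ^+ 2.

Lemma edge_ge0 (R : realType) (n : nat) (B : {set 'S_n}) (f : 'S_n -> R) x a b :
  0 <= edge B f x a b.
Proof. by rewrite mulr_ge0 ?ler0n ?sqr_ge0. Qed.

(** Summing over ordered pairs [(a, b)] counts each transposition twice; pairs with [a = b]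
    contribute 0. *)
Definition cross (R : realType) (n : nat) (A B : {set 'S_n}) (f : 'S_n -> R) : R :=
  \sum_(x in A) \sum_a \sum_b edge B f x a b.

Lemma cross_ge0 (R : realType) (n : nat) (A B : {set 'S_n}) (f : 'S_n -> R) :
  0 <= cross A B f.
Proof. by do 3![apply: sumr_ge0 => ? _]; apply: edge_ge0. Qed.

(** For fixed [a] and [b], right multiplication by [tperm a b] is an involution that swaps the two
    ends of each edge. *)
Lemma crossC (R : realType) (n : nat) (A B : {set 'S_n}) (f : 'S_n -> R) :
  cross A B f = cross B A f.
Proof.
have crossE C D : cross C D f = \sum_a \sum_b \sum_(x : 'S_n)
    ((x \in C) && (x * tperm a b \in D)%g)%:R * (f x - f (x * tperm a b)%g) ^+ 2.
  rewrite /cross exchange_big; apply: eq_bigr => a _ /=.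
  rewrite exchange_big; apply: eq_bigr => b _ /=.
  rewrite big_mkcond; apply: eq_bigr => x _ /=.
  by case: (x \in C); rewrite ?mul0r.
rewrite !crossE; apply: eq_bigr => a _; apply: eq_bigr => b _.
rewrite (reindex_inj (mulIg (tperm a b))) /=; apply: eq_bigr => x _.
by rewrite -mulgA tperm2 mulg1 andbC -sqrrN opprB.
Qed.

Lemma crossUr (R : realType) (n : nat) (A B C : {set 'S_n}) (f : 'S_n -> R) :
  [disjoint B & C] -> cross A (B :|: C) f = cross A B f + cross A C f.
Proof.
move=> BC; rewrite /cross /edge -big_split; apply: eq_bigr => x _ /=.
rewrite -big_split; apply: eq_bigr => a _ /=.
rewrite -big_split; apply: eq_bigr => b _ /=.
rewrite -mulrDl -natrD in_setU; congr (_%:R * _).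
by have := disjointFr BC (x := (x * tperm a b)%g); case: (_ \in B) => [->|_].
Qed.

Lemma cross_setU (R : realType) (n : nat) (A B : {set 'S_n}) (f : 'S_n -> R) :
  [disjoint A & B] ->
  cross (A :|: B) (A :|: B) f = cross A A f + 2 * cross B A f + cross B B f.
Proof.
move=> AB; rewrite crossUr // ![cross (_ :|: _) _ _]crossC !crossUr //.
rewrite (crossC A B); ring.
Qed.

Lemma eq_cross (R : realType) (n : nat) (A : {set 'S_n}) (f g : 'S_n -> R) :
  {in A, f =1 g} -> cross A A f = cross A A g.
Proof.
move=> fg; apply: eq_bigr => x xA; apply: eq_bigr => a _; apply: eq_bigr => b _.
by rewrite /edge; case: (boolP (_ \in A)) => yA; rewrite ?mul0r // !fg.
Qed.

(** * Means, variances and sums over pairs *)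

Lemma sum_sqrB (R : realType) (I : finType) (P : pred I) (f : I -> R) (c : R) :
  \sum_(i | P i) (f i - c) ^+ 2 =
  \sum_(i | P i) f i ^+ 2 - 2 * c * \sum_(i | P i) f i + c ^+ 2 * #|P|%:R.
Proof.
rewrite mulr_sumr -sumrB mulr_natr -sumr_const -big_split /=.
by apply: eq_bigr => i _; ring.
Qed.

Definition mean (R : realType) (I : finType) (P : pred I) (f : I -> R) : R :=
  (\sum_(i | P i) f i) / #|P|%:R.

Lemma sqr_mean_le (R : realType) (I : finType) (P : pred I) (f : I -> R) :
  (0 < #|P|)%N -> #|P|%:R * mean P f ^+ 2 <= \sum_(i | P i) f i ^+ 2.
Proof.
move=> P0; have N0 : (#|P|%:R : R) != 0 by rewrite pnatr_eq0 -lt0n.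
have : 0 <= \sum_(i | P i) (f i - mean P f) ^+ 2.
  by apply: sumr_ge0 => i _; apply: sqr_ge0.
rewrite sum_sqrB.
have -> : \sum_(i | P i) f i = #|P|%:R * mean P f by rewrite /mean; field.
by move: (mean P f) => c; nra.
Qed.

Lemma sum_sqr_pairs (R : realType) (I : finType) (P : pred I) (f : I -> R) :
  (0 < #|P|)%N ->
  \sum_(i | P i) \sum_(j | P j) (f i - f j) ^+ 2 =
  2 * #|P|%:R * \sum_(i | P i) (f i - mean P f) ^+ 2.
Proof.
move=> P0; have N0 : (#|P|%:R : R) != 0 by rewrite pnatr_eq0 -lt0n.
under eq_bigr => i _.
  under eq_bigr => j _ do rewrite -sqrrN opprB.
  rewrite sum_sqrB; over.
rewrite big_split /= sumrB sumr_const -mulr_suml -mulr_suml -mulr_sumr.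
by rewrite sum_sqrB -mulr_natr /mean; field.
Qed.

(* All ordered pairs together give [2 N] times the variance, and the omitted
   pairs [(j, s j)] at most [4] times. *)
Lemma variance_le_pairs (R : realType) (n : nat) (m : 'I_n) (s : 'S_n)
    (f : 'I_n -> R) : let P := [pred j | j != m] in
  (0 < #|P|)%N -> s m = m ->
  (2 * #|P|%:R - 4) * \sum_(j | j != m) (f j - mean P f) ^+ 2 <=
  \sum_(j | j != m) \sum_(l | [&& l != m, l != j & l != s j]) (f j - f l) ^+ 2.
Proof.
move=> P P0 sm; set mu := mean P f; rewrite mulrBl.
have sP j : (s j != m) = (j != m) by rewrite -{1}sm (inj_eq perm_inj).
have /= <- := sum_sqr_pairs f P0.
have split_sj j : j != m -> \sum_(l | l != m) (f j - f l) ^+ 2 =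
    (f j - f (s j)) ^+ 2 +
    \sum_(l | [&& l != m, l != j & l != s j]) (f j - f l) ^+ 2.
  move=> jm; rewrite (bigD1 (s j)) ?sP //=; congr (_ + _).
  rewrite big_mkcond [RHS]big_mkcond; apply: eq_bigr => l _.
  case: (eqVneq l j) => [->|_] /=; last by [].
  by rewrite subrr expr0n /= !if_same.
rewrite (eq_bigr _ split_sj) big_split /= lerBlDr addrC lerD2l.
(* As [s] permutes the indices other than [m], the deviations at [j] and at [s j] have equal totals.
   With [(u - v)^2 <= 2 u^2 + 2 v^2] this gives the 4. *)
have dev_s : \sum_(j | j != m) (f (s j) - mu) ^+ 2 = \sum_(j | j != m) (f j - mu) ^+ 2.
  by rewrite [RHS](reindex_inj (@perm_inj _ s)); apply: eq_bigl => j; rewrite sP.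
have -> : 4 * \sum_(j | j != m) (f j - mu) ^+ 2 =
    \sum_(j | j != m) (2 * (f j - mu) ^+ 2 + 2 * (f (s j) - mu) ^+ 2).
  by rewrite big_split /= -!mulr_sumr dev_s; ring.
apply: ler_sum => j _.
have := sqr_ge0 (f j - mu + (f (s j) - mu)); nra.
Qed.

Lemma edgeC (R : realType) (n : nat) (B : {set 'S_n}) (f : 'S_n -> R) x a b :
  edge B f x a b = edge B f x b a.
Proof. by rewrite /edge tpermC. Qed.

Lemma edge_diag (R : realType) (n : nat) (B : {set 'S_n}) (f : 'S_n -> R) x a :
  edge B f x a a = 0.
Proof. by rewrite /edge tperm1 mulg1 subrr expr0n mulr0. Qed.

(** By symmetry the rows and the columns of [p] and [m] have equal sums, whence the factor 2. The
    excluded entries are the two where these lines cross off the diagonal. *)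
Lemma sum_pairs_ge (R : realType) (I : finType) (g : I -> I -> R) (p m : I) :
    (forall a b, 0 <= g a b) -> (forall a b, g a b = g b a) ->
    (forall a, g a a = 0) -> p != m ->
  2 * (\sum_(b | b != m) g p b + \sum_(b | b != p) g m b) <= \sum_a \sum_b g a b.
Proof.
move=> g0 gC gd pm; pose T q := \sum_(b | (b != p) && (b != m)) g q b.
have row q : \sum_b g q b = g q p + g q m + T q.
  by rewrite (bigD1 p) //= (bigD1 m) 1?eq_sym //= addrA.
have -> : \sum_(b | b != m) g p b = T p.
  by rewrite (bigD1 p) //= gd add0r; apply: eq_bigl => b; rewrite andbC.
have -> : \sum_(b | b != p) g m b = T m by rewrite (bigD1 m) 1?eq_sym //= gd add0r.
rewrite (bigD1 p) //= row (bigD1 m) 1?eq_sym //= row !gd.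
have : T p + T m <= \sum_(a | (a != p) && (a != m)) \sum_b g a b.
  rewrite -big_split; apply: ler_sum => a _ /=.
  by rewrite row (gC p) (gC m) lerDl sumr_ge0.
have := g0 p m; have := g0 m p; lra.
Qed.

(** * Extension by averaging when one point is released *)

Definition extend (R : realType) (n : nat) (m : 'I_n) (f : 'S_n -> R) (s : 'S_n) : R :=
  if s m == m then mean [pred j | j != m] (fun j => f (s * tperm m j)%g) else f s.

Lemma extend_avoid (R : realType) (n : nat) (F : {set 'I_n}) (m : 'I_n)
  (f : 'S_n -> R) : m \in F -> {in avoid F, extend m f =1 f}.
Proof. by move=> mF s /avoidP sF; rewrite /extend (negPf (sF m mF)). Qed.

Lemma extend_fix (R : realType) (n : nat) (F : {set 'I_n}) (m : 'I_n)
    (f : 'S_n -> R) (s : 'S_n) : s \in avoid_fix F m ->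
  extend m f s = mean [pred j | j != m] (fun j => f (s * tperm m j)%g).
Proof. by rewrite in_avoid_fix /extend => /andP[_ ->]. Qed.

(* Inserting [m] into [x] at [j] and into [x (a b)] at [(a b) j] gives adjacent
   permutations. *)
Lemma cross_fix_fix (R : realType) (n : nat) (F : {set 'I_n}) (m : 'I_n)
    (f : 'S_n -> R) : (0 < #|[pred j | j != m]|)%N ->
  #|[pred j | j != m]|%:R * cross (avoid_fix F m) (avoid_fix F m) (extend m f) <=
  cross (avoid F) (avoid F) f.
Proof.
move=> N0.
pose G x := \sum_a \sum_b edge (avoid F) f x a b.
have G0 x : 0 <= G x by do 2![apply: sumr_ge0 => ? _]; apply: edge_ge0.
apply: le_trans (sum_insert F m G0).
rewrite /cross mulr_sumr; apply: ler_sum => x xY.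
rewrite /G [leRHS]exchange_big mulr_sumr; apply: ler_sum => a _ /=.
rewrite [leRHS]exchange_big mulr_sumr; apply: ler_sum => b _ /=.
rewrite {1}/edge; set t := tperm a b.
case: (boolP (x * t \in avoid_fix F m)%g) => yY; last first.
  by rewrite mul0r mulr0; apply: sumr_ge0 => j _; apply: edge_ge0.
have tm : t m = m.
  by move: xY yY; rewrite !in_avoid_fix permM => /andP[_ /eqP ->] /andP[_ /eqP].
(* As [t] fixes [m], it conjugates [(m j)] to [(m (t j))]. Reindexing the second mean by [t]
   therefore turns the difference of means into a mean of edge differences. *)
have tC j : (x * t * tperm m (t j) = x * tperm m j * t)%g.
  by rewrite -{1}tm -tpermJ conjgE -!mulgA mulKVg.
rewrite mul1r (extend_fix f xY) (extend_fix f yY).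
have -> : mean [pred j | j != m] (fun j => f (x * t * tperm m j)%g) =
          mean [pred j | j != m] (fun j => f (x * tperm m j * t)%g).
  congr (_ / _); rewrite (reindex_inj (@perm_inj _ t)) /=.
  apply: eq_big => [j|j _]; first by rewrite -{1}tm (inj_eq perm_inj).
  by rewrite tC.
rewrite /mean -mulrBl -sumrB.
apply: le_trans (sqr_mean_le _ N0) _; apply: ler_sum => j jm.
by rewrite /edge -/t -tC insert_avoid ?mul1r // -{1}tm (inj_eq perm_inj).
Qed.

(** The far end must move [m], so the transposition is some [(m j)]; it occurs as [(m, j)] and as
    [(j, m)], which gives the factor 2. *)
Lemma cross_fix_avoid (R : realType) (n : nat) (F : {set 'I_n}) (m : 'I_n)
    (f : 'S_n -> R) : m \in F ->
  cross (avoid_fix F m) (avoid F) (extend m f) =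
  2 * \sum_(x in avoid_fix F m) \sum_(j | j != m)
    (f (x * tperm m j)%g - extend m f x) ^+ 2.
Proof.
move=> mF; rewrite mulr_sumr; apply: eq_bigr => x xY.
have xm : x m = m by move: xY; rewrite in_avoid_fix => /andP[_ /eqP].
pose e a b := edge (avoid F) (extend m f) x a b.
have e0 a b : a != m -> b != m -> e a b = 0.
  move=> am bm; rewrite /e /edge; case: avoidP => [/(_ m mF)|]; last by rewrite mul0r.
  by rewrite permM xm tpermD ?eqxx.
have em j : j != m -> e m j = (f (x * tperm m j)%g - extend m f x) ^+ 2.
  move=> jm; rewrite /e /edge insert_avoid // mul1r -sqrrN opprB.
  by rewrite (extend_avoid _ mF) // insert_avoid.
have eC a b : e a b = e b a by apply: edgeC.
rewrite -[LHS]/(\sum_a \sum_b e a b).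
rewrite (bigD1 m) //= (bigD1 m) //= [e m m]edge_diag add0r.
rewrite mulrDl mul1r (eq_bigr _ em); congr (_ + _).
apply: eq_bigr => a am; rewrite (bigD1 m) //= big1 ?addr0 => [|b bm].
  by rewrite eC em.
exact: e0.
Qed.

Lemma variance_le_cross (R : realType) (n : nat) (F : {set 'I_n}) (m : 'I_n)
    (f : 'S_n -> R) : m \in F -> (0 < #|[pred j | j != m]|)%N ->
  (2 * #|[pred j | j != m]|%:R - 4) *
  \sum_(x in avoid_fix F m) \sum_(j | j != m)
    (f (x * tperm m j)%g - extend m f x) ^+ 2 <=
  cross (avoid F) (avoid F) f.
Proof.
move=> mF N0; pose e := edge (avoid F) f.
(* Seen from an inserted point [y], a path leaves by a transposition [(y m, l)] or is entered from
   its other end by [(m j)]; [G y] collects both kinds. *)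
pose G x := \sum_(l | l != m) e x (x m) l + \sum_(j | j != x m) e x m j.
have e0 x a b : 0 <= e x a b by apply: edge_ge0.
have G0 x : 0 <= G x by rewrite addr_ge0 ?sumr_ge0.
(* This 2 is the cost of a path of two edges; it is absorbed by the factor 2 in [sum_pairs_ge]. *)
apply: (@le_trans _ _ (2 * \sum_(x in avoid F) G x)); last first.
  rewrite mulr_sumr; apply: ler_sum => x /avoidP/(_ m mF) xm.
  apply: (@sum_pairs_ge R _ (e x)) => //; [exact: edgeC|exact: edge_diag].
apply: le_trans (ler_wpM2l (ler0n R 2) (sum_insert F m G0)).
rewrite !mulr_sumr; apply: ler_sum => x xY.
have xm : x m = m by move: xY; rewrite in_avoid_fix => /andP[_ /eqP].
rewrite (extend_fix f xY).
have /= := variance_le_pairs (fun j => f (x * tperm m j)%g) N0 xm.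
move/le_trans; apply.
pose good (j l : 'I_n) := [&& l != m, l != j & l != x j].
have path2 j l : j != m -> good j l ->
    (f (x * tperm m j)%g - f (x * tperm m l)%g) ^+ 2 <=
    2 * (e (x * tperm m j)%g j l + e (x * tperm m l)%g m j).
  move=> jm /and3P[lm lj lxj]; rewrite /e /edge.
  have -> : (x * tperm m l * tperm m j = x * tperm m j * tperm j l)%g.
    rewrite -!mulgA; congr (_ * _)%g; rewrite [LHS]conjgC tpermJ.
    by rewrite tpermL tpermD // eq_sym.
  rewrite (insert_cycle_avoid xY) // !mul1r.
  set u := f _; set v := f (x * _)%g; set w := f _.
  have := sqr_ge0 (u - 2 * w + v); nra.
apply: (@le_trans _ _ (\sum_(j | j != m)
    2 * (\sum_(l | good j l) e (x * tperm m j)%g j l +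
         \sum_(l | good j l) e (x * tperm m l)%g m j))).
  apply: ler_sum => j jm; rewrite -big_split mulr_sumr.
  by apply: ler_sum => l; apply: path2.
rewrite -mulr_sumr ler_wpM2l // [leLHS]big_split [leRHS]big_split /=.
have insm j : (x * tperm m j)%g m = j by rewrite permM xm tpermL.
apply: lerD.
  apply: ler_sum => j jm; rewrite insm.
  rewrite big_mkcond [leRHS]big_mkcond; apply: ler_sum => l _ /=.
  by rewrite /good; case: (l != m) => //=; case: ifP.
(* The second halves of the paths are regrouped by their end [x (m l)]. *)
rewrite (exchange_big_dep (fun l => l != m)) /=; last by move=> j l _ /and3P[].
apply: ler_sum => l lm; rewrite insm.
rewrite big_mkcond [leRHS]big_mkcond; apply: ler_sum => j _ /=.
rewrite /good (eq_sym j l); case: (l != j) => /=; rewrite ?andbF //.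
by case: ifP.
Qed.

Lemma card_neq (n : nat) (m : 'I_n) : #|[pred j | j != m]| = n.-1.
Proof. by rewrite -[RHS](congr1 predn (card_ord n)) -(cardC1 m); apply: eq_card. Qed.

(** The old energy [A] gains [B <= A / (n - 1)] between new points and [4 V] between new and old
    ones, where [2 (n - 3) V <= A]. *)
Lemma cross_extend_le (R : realType) (n : nat) (F : {set 'I_n}) (m : 'I_n)
    (f : 'S_n -> R) : (3 < n)%N -> m \in F ->
  cross (avoid (F :\ m)) (avoid (F :\ m)) (extend m f) <=
  (1 + 1 / (n%:R - 1) + 2 / (n%:R - 3)) * cross (avoid F) (avoid F) f.
Proof.
move=> n3 mF; have N0 : (0 < #|[pred j | j != m]|)%N.
  by rewrite card_neq -subn1 subn_gt0 (ltn_trans _ n3).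
have Nn : (#|[pred j | j != m]|%:R : R) = n%:R - 1.
  by rewrite card_neq -subn1 natrB // (leq_trans _ n3).
have n3R : (3 : R) < n%:R by rewrite ltr_nat.
rewrite avoidD1 // cross_setU ?avoid_disjoint //.
rewrite (eq_cross (extend_avoid f mF)) cross_fix_avoid //.
have := cross_fix_fix F f N0; have := variance_le_cross f mF N0; rewrite Nn.
set A := cross _ _ f; set V := \sum_(x in _) _; set B := cross _ _ _.
move: (n%:R : R) n3R => r r3 VA BA.
have Bd : B <= A / (r - 1) by rewrite ler_pdivlMr; lra.
have Vd : V <= A / (2 * (r - 3)) by rewrite ler_pdivlMr; lra.
have -> : (1 + 1 / (r - 1) + 2 / (r - 3)) * A = A + A / (r - 1) + 4 * (A / (2 * (r - 3))).
  by field; lra.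
lra.
Qed.

(** Taking [G = 1] in [sum_insert] shows that [n - 1] times the number of new points is at most the
    number of old ones. *)
Lemma card_avoidD1_le (R : realType) (n : nat) (F : {set 'I_n}) (m : 'I_n) :
  (1 < n)%N -> m \in F ->
  #|avoid (F :\ m)|%:R <= n%:R / (n%:R - 1) * #|avoid F|%:R :> R.
Proof.
move=> n1 mF; have := @sum_insert R n F m (fun=> 1) (fun=> ler01).
under eq_bigr => s _ do rewrite sumr_const.
rewrite !sumr_const card_neq avoidD1 // cardsU disjoint_setI0 ?avoid_disjoint //.
rewrite cards0 subn0 natrD -mulr_natr -subn1 natrB ?(ltnW n1) //.
have : (1 : R) < n%:R by rewrite ltr1n.
move: (n%:R : R) => r r1 Yle.
by rewrite -mulrAC ler_pdivlMr ?subr_gt0 //; nra.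
Qed.


(** * From pairs of indices to adjacency *)

Lemma tperm_eq1 (n : nat) (i j : 'I_n) : (tperm i j == 1%g) = (i == j).
Proof.
apply/eqP/eqP => [t1|->]; last exact: tperm1.
by rewrite -(tpermL i j) t1 perm1.
Qed.

Lemma tperm_eqE (n : nat) (i j a b : 'I_n) : i != j ->
  (tperm a b == tperm i j) = ((a, b) == (i, j)) || ((a, b) == (j, i)).
Proof.
move=> ij; apply/eqP/idP; last by case/orP => /eqP[-> ->] //; exact: tpermC.
move=> tt; have := congr1 (fun s : 'S_n => s i) tt; rewrite tpermL.
case: tpermP => [->|->|_ _ /eqP]; last by rewrite (negPf ij).
- by move=> ->; rewrite eqxx.
- by move=> ->; rewrite eqxx orbT.
Qed.

Lemma sum_transposition (R : realType) (n : nat) (H : 'S_n -> R) : H 1%g = 0 ->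
  \sum_a \sum_b H (tperm a b) = 2 * \sum_(s | is_transposition s) H s.
Proof.
move=> H1; rewrite pair_big /=.
rewrite (partition_big (fun p : 'I_n * 'I_n => tperm p.1 p.2) predT) //=.
rewrite mulr_sumr [RHS]big_mkcond; apply: eq_bigr => s _.
rewrite (eq_bigr (fun=> H s)) => [|p /eqP -> //]; rewrite sumr_const.
case: ifPn => [/existsP[i /existsP[j /andP[ij /eqP ->]]]|nts].
  rewrite mulr_natl; congr (_ *+ _).
  transitivity #|[set (i, j); (j, i)]|.
    by apply: eq_card => -[a b]; rewrite !inE -tperm_eqE.
  by rewrite cards2 xpair_eqE negb_and ij.
case: (eqVneq s 1%g) => [->|s1]; first by rewrite H1 mul0rn.
rewrite eq_card0 // => -[a b]; apply: contraNF nts => ab_s.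
have ab : tperm a b = s by apply/eqP; apply: ab_s.
apply/existsP; exists a; apply/existsP; exists b.
by rewrite ab eqxx andbT -tperm_eq1 ab.
Qed.

Lemma sum_adj (R : realType) (n : nat) (A : {set 'S_n}) (f : 'S_n -> R) :
  \sum_(x in A) \sum_(y in A) (adj x y)%:R * (f x - f y) ^+ 2 = cross A A f / 2.
Proof.
rewrite /cross mulr_suml; apply: eq_bigr => x xA.
(* Adjacency tests [y^-1 * x], which equals [s] when [y = x * s^-1]. *)
pose H s := (x * s^-1 \in A)%g%:R * (f x - f (x * s^-1)%g) ^+ 2.
have -> : \sum_a \sum_b edge A f x a b =
    \sum_a \sum_b H (tperm a b).
  by apply: eq_bigr => a _; apply: eq_bigr => b _; rewrite /H tpermV.
rewrite sum_transposition; last by rewrite /H invg1 mulg1 subrr expr0n mulr0.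
rewrite mulrC mulKf ?pnatr_eq0 // big_mkcond.
rewrite (reindex_inj (inj_comp (mulgI x) invg_inj)) /=.
rewrite [RHS]big_mkcond; apply: eq_bigr => s _.
rewrite /H /adj invMg invgK mulgKV.
by case: (_ \in A); case: is_transposition; rewrite ?mul0r ?mul1r.
Qed.

(** * Releasing the points one by one, from derangements to all permutations *)

Definition tail (n k : nat) : {set 'I_n} := [set i : 'I_n | (k <= i)%N].

Lemma avoid_tail0 (n : nat) : avoid (tail n 0) = derangements n.
Proof.
apply/setP => s; rewrite !inE; apply: eq_forallb => i.
by rewrite inE.
Qed.

Lemma avoid_tail_max (n : nat) : avoid (tail n n) = [set: 'S_n].
Proof.
apply/setP => s; rewrite in_setT; apply/avoidP => i.
by rewrite inE leqNgt ltn_ord.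
Qed.

Lemma tailS (n : nat) (m : 'I_n) : tail n m.+1 = tail n m :\ m.
Proof. by apply/setP => i; rewrite !inE ltn_neqAle eq_sym. Qed.

Lemma extension_exists (R : realType) (n : nat) (f : 'S_n -> R) (k : nat) :
  (3 < n)%N -> (k <= n)%N -> exists2 g : 'S_n -> R,
    {in derangements n, g =1 f} &
    cross (avoid (tail n k)) (avoid (tail n k)) g <=
    (1 + 1 / (n%:R - 1) + 2 / (n%:R - 3)) ^+ k *
    cross (derangements n) (derangements n) f.
Proof.
move=> n3; elim: k => [_|k IHk kn].
  by exists f => //; rewrite avoid_tail0 expr0 mul1r.
have [g gf gE] := IHk (ltnW kn); pose m := Ordinal kn.
have mF : m \in tail n m by rewrite inE.
exists (extend m g).
  move=> s sD; rewrite -(gf s sD); apply: (extend_avoid g mF).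
  by apply/avoidP => i _; move: sD; rewrite inE => /forallP.
rewrite (tailS m); apply: le_trans (cross_extend_le g n3 mF) _.
rewrite exprS -[leRHS]mulrA ler_wpM2l //.
have n3R : (3 : R) < n%:R by rewrite ltr_nat.
by rewrite !addr_ge0 // divr_ge0 //; lra.
Qed.

Lemma card_derangements_ge (R : realType) (n : nat) : (1 < n)%N ->
  n`!%:R <= (n%:R / (n%:R - 1)) ^+ n * #|derangements n|%:R :> R.
Proof.
move=> n1.
have card_tail k : (k <= n)%N -> #|avoid (tail n k)|%:R <=
    (n%:R / (n%:R - 1)) ^+ k * #|derangements n|%:R :> R.
  elim: k => [_|k IHk kn]; first by rewrite avoid_tail0 mul1r.
  pose m := Ordinal kn; rewrite (tailS m).
  have mF : m \in tail n m by rewrite inE.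
  apply: le_trans (card_avoidD1_le R n1 mF) _.
  rewrite exprS -[leRHS]mulrA ler_wpM2l ?IHk 1?ltnW //.
  by rewrite divr_ge0 // subr_ge0 ler1n ltnW.
by have := card_tail n (leqnn n); rewrite avoid_tail_max cardsT card_Sn.
Qed.

(** * Dirichlet forms as normalised energies *)

(** Diagonal terms vanish with [f x - f x]. The map [u] is the identity on [S_n] or the inclusion of
    [D_n], so both kernels are covered. *)
Lemma dirichlet_adj (R : realType) (n : nat) (X : finType) (u : X -> 'S_n)
    (P : X -> X -> R) (pi c : R) (f : X -> R) :
    (forall x y, x != y -> P x y = c * (adj (u x) (u y))%:R) ->
  dirichlet P (fun=> pi) f =
  c * pi / 2 * \sum_x \sum_y (adj (u x) (u y))%:R * (f x - f y) ^+ 2.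
Proof.
move=> PE; rewrite /dirichlet !mulr_sumr.
apply: eq_bigr => x _; rewrite !mulr_sumr; apply: eq_bigr => y _.
case: (eqVneq x y) => [->|/PE ->]; first by rewrite subrr normr0 !expr0n /=; ring.
by rewrite -normrX ger0_norm ?sqr_ge0 //; field.
Qed.

(** The 8 has a factor 2 from each of the Dirichlet form, the kernel, and the double count of
    transpositions in [cross]. *)
Lemma formK_cross (R : realType) (n : nat) (f : 'S_n -> R) :
  formK f = (8 * 'C(n, 2)%:R)^-1 / n`!%:R * cross setT setT f.
Proof.
rewrite /formK (@dirichlet_adj _ _ _ id _ _ (1 / (2 * 'C(n, 2)%:R))); last first.
  by move=> x y /negPf xy; rewrite /kerK xy; case: ifP; rewrite ?mulr1 ?mulr0.
have sumT (h : 'S_n -> R) : \sum_(x in [set: 'S_n]) h x = \sum_x h x.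
  by apply: eq_bigl => x; rewrite in_setT.
have := sum_adj [set: 'S_n] f; rewrite sumT.
under eq_bigr => x _ do rewrite sumT.
move=> ->; rewrite /uniform card_Sn !invfM.
move: ('C(n, 2)%:R^-1) (n`!%:R^-1) (cross _ _ _) => c N A; by field.
Qed.

Lemma formQ_cross (R : realType) (n : nat) (f : D_ n -> R) (g : 'S_n -> R) :
  extends g f -> formQ f = (8 * 'C(n, 2)%:R)^-1 / #|derangements n|%:R *
    cross (derangements n) (derangements n) g.
Proof.
move=> gf; rewrite /formQ.
rewrite (@dirichlet_adj _ _ _ val _ _ (1 / (2 * 'C(n, 2)%:R))); last first.
  by move=> x y /negPf xy; rewrite /kerQ xy; case: ifP; rewrite ?mulr1 ?mulr0.
have := sum_adj (derangements n) g; rewrite big_sub.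
under eq_bigr => x _ do rewrite big_sub.
under eq_bigr => x _ do under eq_bigr => y _ do rewrite !gf.
move=> ->; rewrite /uniform card_sig; rewrite !invfM.
move: ('C(n, 2)%:R^-1) (#|derangements n|%:R^-1) (cross _ _ _) => c N A; by field.
Qed.



(** * Numerical bounds on the accumulated factors *)

(** With [k = n - 1] the left side is [(1 + 1 / k) * (1 + 1 / k) ^ k], at most [2] times [e]. *)
Lemma rate_D_le (R : realType) (n : nat) : (1 < n)%N ->
  (n%:R / (n%:R - 1)) ^+ n <= 2 * expR 1 :> R.
Proof.
case: n => [//|n n0]; have n0R : (1 : R) <= n%:R by rewrite ler1n.
rewrite -natr1 addrK exprSr mulrC.
have -> : (n%:R + 1) / n%:R = 1 + n%:R^-1 :> R.
  by rewrite mulrDl mul1r divff // gt_eqF // (lt_le_trans ltr01).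
apply: ler_pM.
- by rewrite addr_ge0 ?invr_ge0.
- by rewrite exprn_ge0 // addr_ge0 ?invr_ge0.
- by rewrite (_ : 2 = 1 + 1) // lerD2l invf_le1 // (lt_le_trans ltr01).
apply: le_trans (_ : expR n%:R^-1 ^+ n <= _).
  by rewrite lerXn2r ?expR_ge1Dx // nnegrE ?expR_ge0 // addr_ge0 ?invr_ge0.
by rewrite -expRM_natr mulVf // gt_eqF // (lt_le_trans ltr01).
Qed.

(** From [e >= 2] the right side is at least 66. Inverting [e ^ (-1/20) >= 19/20] and raising to
    powers 4 and 5, with rounding, gives [e <= 17/6], and [(17/6) ^ 4 < 66]. *)
Lemma expR4_le (R : realType) : expR 4 <= 22 * (expR 1 + 1) :> R.
Proof.
have e2 : 2 <= expR 1 :> R by apply: le_trans (expR_ge1Dx 1); lra.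
have e20 : expR (1 / 20) <= 20 / 19 :> R.
  have := expR_ge1Dx (- (1 / 20) : R).
  have := expR_gt0 (1 / 20 : R); rewrite expRN; move: (expR _) => u u0.
  by rewrite -[u^-1]mul1r ler_pdivlMr //; lra.
have e5 : expR (1 / 5) <= 16 / 13 :> R.
  rewrite (_ : 1 / 5 = 1 / 20 * 4%:R); last by field.
  rewrite expRM_natr; apply: (@le_trans _ _ ((20 / 19) ^+ 4)); last by lra.
  by rewrite lerXn2r ?nnegrE ?expR_ge0 //; lra.
have e1 : expR 1 <= 17 / 6 :> R.
  rewrite [in leLHS](_ : 1 = 1 / 5 * 5%:R); last by field.
  rewrite expRM_natr; apply: (@le_trans _ _ ((16 / 13) ^+ 5)); last by lra.
  by rewrite lerXn2r ?nnegrE ?expR_ge0 //; lra.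
apply: (@le_trans _ _ 66); last by lra.
rewrite (_ : 4 = 1 * 4%:R); last by rewrite mul1r.
rewrite expRM_natr; apply: (@le_trans _ _ ((17 / 6) ^+ 4)); last by lra.
by rewrite lerXn2r ?nnegrE ?expR_ge0 //; lra.
Qed.

(** By [1 + x <= e ^ x] the exponent is [n / (n - 1) + 2 n / (n - 3)], at most its value
    [10/9 + 20/7 < 4] at [n = 10]. *)
Lemma rate_K_le (R : realType) (n : nat) : (10 <= n)%N ->
  (1 + 1 / (n%:R - 1) + 2 / (n%:R - 3)) ^+ n <= 22 * (expR 1 + 1) :> R.
Proof.
move=> n10; apply: le_trans (expR4_le R).
have n10R : (10 : R) <= n%:R by rewrite ler_nat.
apply: (@le_trans _ _ (expR (1 / (n%:R - 1) + 2 / (n%:R - 3)) ^+ n)).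
  rewrite lerXn2r ?nnegrE ?expR_ge0 //; last by rewrite -addrA expR_ge1Dx.
  by rewrite !addr_ge0 // divr_ge0 //; lra.
rewrite -expRM_natr ler_expR; move: (n%:R : R) n10R => r r10.
have r1 : 1 / (r - 1) * r <= 10 / 9 by rewrite mulrAC ler_pdivrMr; lra.
have r3 : 2 / (r - 3) * r <= 20 / 7 by rewrite mulrAC ler_pdivrMr; lra.
rewrite mulrDl; lra.
Qed.

(** * Both comparisons of the normalised forms *)

Theorem theorem7 (R : realType) (n : nat) (hn : (10 <= n)%N) :
  (exists eps : R, `|eps| <= 13 / n%:R /\
     forall f : D_ n -> R, exists fhat : 'S_n -> R,
       extends fhat f /\
       formK fhat <= 22 * (expR 1 + 1) * (1 + eps) * formQ f) /\
  (forall (f : D_ n -> R) (fhat : 'S_n -> R), extends fhat f ->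
     formK fhat >= 1 / (2 * expR 1) * formQ f).
Proof.
have n1 : (1 < n)%N by apply: leq_trans hn.
have e0 : 0 < expR 1 :> R := expR_gt0 1.
have e_ge0 := ltW e0.
have fact0 : (0 : R) < n`!%:R by rewrite ltr0n fact_gt0.
have c0 : 0 <= (8 * 'C(n, 2)%:R)^-1 :> R by rewrite invr_ge0 mulr_ge0.
have Dge := le_trans (card_derangements_ge R n1)
              (ler_wpM2r (ler0n _ _) (rate_D_le R n1)).
have D0 : (0 : R) < #|derangements n|%:R.
  by have := lt_le_trans fact0 Dge; rewrite pmulr_rgt0 // mulr_gt0.
split.
  exists 0; split; first by rewrite normr0 divr_ge0.
  (* The value 0 off [D_n] is a placeholder: the energy on [D_n] and the agreement with [g] only
     read [f0] at derangements. *)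
  move=> f; pose f0 s := if insub s is Some x then f x else 0.
  have f0E : extends f0 f by move=> x; rewrite /f0 valK.
  have [g gf gE] := extension_exists f0 (leq_trans (isT : 3 < 10)%N hn) (leqnn n).
  exists g; split; first by move=> x; rewrite gf ?f0E // (valP x).
  have gE' : cross setT setT g <=
      22 * (expR 1 + 1) * cross (derangements n) (derangements n) f0.
    rewrite -avoid_tail_max; apply: le_trans gE _.
    by rewrite ler_wpM2r ?cross_ge0 ?rate_K_le.
  rewrite formK_cross (formQ_cross f0E) addr0 mulr1.
  apply: le_trans (ler_wpM2l _ gE') _; first by rewrite divr_ge0 // ltW.
  rewrite mulrCA ler_wpM2l ?mulr_ge0 ?addr_ge0 //.
  (* The change of normalisation goes the right way because [|D_n| <= n!]. *)
  rewrite ler_wpM2r ?cross_ge0 // ler_wpM2l // lef_pV2 ?posrE //.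
  by rewrite ler_nat -card_Sn max_card.
move=> f g gf; rewrite formK_cross (formQ_cross gf) mulrA.
apply: ler_pM; rewrite ?cross_ge0 ?mulr_ge0 ?invr_ge0 ?mulr_ge0 ?ler0n //.
  (* Here the normalisations are compared by [Dge], that is [n! <= 2 e |D_n|]. *)
  rewrite mul1r mulrCA ler_wpM2l // -invfM lef_pV2 ?posrE ?mulr_gt0 //.
(* Edges with an end outside [D_n] only add energy. *)
rewrite -(setUCr (derangements n)) cross_setU; last by rewrite -subsets_disjoint.
by rewrite -addrA lerDl addr_ge0 ?mulr_ge0 ?cross_ge0.
Qed.
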